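(* For every subsemigroup $D$ of $(\mathbb{N}_0,+)$, the set $\mathcal I_D$ is a category of partitions.
   Context: A (two-colored) partition $p$ consists of two finite totally ordered sets $U$ (upper row, ordered left to right) and $L$ (lower row), a decomposition of the disjoint union $U\sqcup L$ (the points of $p$) into non-empty pairwise disjoint subsets (blocks), and a coloring of every point by white $\circ$ or black $\bullet$. A pair partition is one all of whose blocks have exactly two points. Operations: the tensor product $p\otimes p'$ appends each row of $p'$ to the right of the corresponding row of $p$; the involution $p^*$ exchanges upper and lower row; if the lower row of $p'$ and the upper row of $p$ agree in length and coloring, the composition $pp'$ is obtained by placing $p'$ on top of $p$, identifying the lower row of $p'$ with the upper row of $p$, taking the upper row of $p'$ as upper row and the lower row of $p$ as lower row, and declaring two remaining points to lie in the same block iff they are connected through blocks of $p$ and $p'$ via the identified middle points (components lying entirely in the middle are discarded). A category of partitions is a set of partitions closed under tensor products, compositions (whenever defined) and involution, and containing the two partitions with one upper and one lower point, both of the same color $c\in\{\circ,\bullet\}$, forming one block, and the two partitions with empty upper row and lower row $\circ\bullet$ resp. $\bullet\circ$ whose two points form one block. Cyclic order and color sum: on the points of $p$ consider the cyclic order obtained by traversing the lower row from left to right, then the upper row from right to left, then returning to the leftmost lower point. For points $\alpha,\beta$, $]\alpha,\beta[$ denotes the set of points strictly after $\alpha$ and strictly before $\beta$ in this cyclic order, and $]\alpha,\beta]:=]\alpha,\beta[\cup\{\beta\}$ if $\alpha\ne\beta$, $]\alpha,\alpha]:=\emptyset$. The normalized color of a lower point is its color, that of an upper point the opposite color. For a set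 $S$ of points, $\sigma_p(S)$ is the number of points of normalized color $\circ$ in $S$ minus the number of points of normalized color $\bullet$ in $S$. Two distinct blocks $B,B'$ cross if there are points $\alpha,\beta\in B$, $\gamma,\delta\in B'$ occurring in the cyclic order in the order $\alpha,\gamma,\beta,\delta$. $\mathcal P^{\circ\bullet}_{2,\mathrm{nb}}$ is the set of pair partitions each of whose blocks contains one point of normalized color $\circ$ and one of normalized color $\bullet$. $\mathcal S_0$ is the set of $p\in\mathcal P^{\circ\bullet}_{2,\mathrm{nb}}$ such that $\sigma_p(]\alpha,\beta[)=0$ for every block $\{\alpha,\beta\}$ of $p$. For $p\in\mathcal S_0$ and points $\alpha,\beta$ put $\delta_p(\alpha,\beta)=\sigma_p(]\alpha,\beta[)$ if $\alpha,\beta$ have different normalized colors and $\delta_p(\alpha,\beta)=\sigma_p(]\alpha,\beta])$ otherwise; for blocks $B,B'$ of $p\in\mathcal S_0$ the value $\delta_p(\alpha,\alpha')$ is independent of the choice $\alpha\in B,\alpha'\in B'$, and $d_p(B,B'):=|\delta_p(\alpha,\alpha')|$. A subsemigroup of $(\mathbb N_0,+)$ is a (possibly empty) subset closed under addition. For such $D$, $\mathcal I_D$ is the set of all $p\in\mathcal S_0$ such that $d_p(B,B')\notin D$ for all pairs of crossing blocks $B,B'$ of $p$. *)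

(* Defs.v *)
From mathcomp Require Import all_boot all_order all_algebra.
Set Implicit Arguments. Unset Strict Implicit. Unset Printing Implicit Defensive.
Import Order.TTheory GRing.Theory Num.Theory.

Definition white : bool := true.
Definition black : bool := false.

(* A two-colored partition.
   - [up p] : colors of the upper row, left to right;
   - [lo p] : colors of the lower row, left to right;
   - points are numbered 0 .. npts p - 1 along the cyclic order of the paper:
     index i < size (lo p) is the i-th lower point (left to right),
     index size (lo p) + t is the t-th upper point counted from the RIGHT
     (i.e. the upper point at position (size (up p)).-1 - t from the left);
   - [blk p i j] : points i and j lie in the same block (only meaningful on
     points, i.e. for i, j < npts p).
   A "set of partitions" is encoded as a predicate on such representations
   that only holds for well-formed ones ([wf]) and is invariant under
   representation equivalence ([peq]). *)
Record partition := Partition { up : seq bool; lo : seq bool; blk : nat -> nat -> bool }.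

Definition npts (p : partition) : nat := size (lo p) + size (up p).

Definition col (p : partition) (i : nat) : bool :=
  if i < size (lo p) then nth false (lo p) i
  else nth false (up p) ((size (up p)).-1 - (i - size (lo p))).

Definition ncol (p : partition) (i : nat) : bool :=
  if i < size (lo p) then col p i else ~~ col p i.

Definition wf (p : partition) : Prop :=
  (forall i, i < npts p -> blk p i i) /\
  (forall i j, i < npts p -> j < npts p -> blk p i j = blk p j i) /\
  (forall i j k, i < npts p -> j < npts p -> k < npts p ->
      blk p i j -> blk p j k -> blk p i k).

Definition peq (p q : partition) : Prop :=
  up p = up q /\ lo p = lo q /\
  (forall i j, i < npts p -> j < npts p -> blk p i j = blk q i j).

(* location in (p, p') of a point of p (x) p' : (true, a) = point a of p,
   (false, a) = point a of p' *)
Definition tens_loc (p p' : partition) (i : nat) : bool * nat :=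
  let l1 := size (lo p) in let l2 := size (lo p') in let k2 := size (up p') in
  if i < l1 then (true, i)
  else if i < l1 + l2 then (false, i - l1)
  else if i < l1 + l2 + k2 then (false, i - l1)
  else (true, i - l2 - k2).

Definition tensor (p p' : partition) : partition :=
  Partition (up p ++ up p') (lo p ++ lo p')
    (fun i j => match tens_loc p p' i, tens_loc p p' j with
                | (true, a), (true, b) => blk p a b
                | (false, a), (false, b) => blk p' a b
                | _, _ => false
                end).

(* exchanging the rows reverses the cyclic order *)
Definition involution (p : partition) : partition :=
  Partition (lo p) (up p)
    (fun i j => blk p ((npts p).-1 - i) ((npts p).-1 - j)).

(* Combined graph: nodes 0 .. N'-1 are the points of p' (N' = npts p'),
   nodes N' .. N'+npts p-1 are the points of p (shifted by N').  Edges: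
   blocks of p', blocks of p, and the identification of the i-th lower point
   of p' (node i) with the i-th upper point (from the left) of p
   (node N' + size (lo p) + (m.-1 - i), m = size (lo p') = size (up p)).
   Points of the composition: lower row = lower row of p, upper row = upper
   row of p'; two of them are in the same block iff connected in the graph. *)
Definition pcompose (p p' : partition) : partition :=
  let m := size (lo p') in let l := size (lo p) in
  let N' := npts p' in let N := N' + npts p in
  let e := fun x y : nat => (x < N) && (y < N) &&
     [|| (x < N') && (y < N') && blk p' x y,
         (N' <= x) && (N' <= y) && blk p (x - N') (y - N'),
         (x < m) && (y == N' + l + (m.-1 - x)) |
         (y < m) && (x == N' + l + (m.-1 - y)) ] in
  let loc := fun i => if i < l then N' + i else i - l + m in
  Partition (up p') (lo p)
    (fun i j => connect (fun x y : 'I_N.+1 => e x y)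
                        (inord (loc i)) (inord (loc j))).

Definition idp (c : bool) : partition := Partition [:: c] [:: c] (fun _ _ => true).
Definition pairp (c d : bool) : partition := Partition [::] [:: c; d] (fun _ _ => true).

Definition category (C : partition -> Prop) : Prop :=
  (forall p, C p -> wf p) /\
  (forall p q, C p -> peq p q -> C q) /\
  (forall p q, C p -> C q -> C (tensor p q)) /\
  (forall p q, C p -> C q -> lo q = up p -> C (pcompose p q)) /\
  (forall p, C p -> C (involution p)) /\
  C (idp white) /\ C (idp black) /\
  C (pairp white black) /\ C (pairp black white).

Definition cdist (n a x : nat) : nat := (x + n - a) %% n.
(* x \in ]a,b[  (empty when a = b) *)
Definition in_oo (n a b x : nat) : bool :=
  (x < n) && (0 < cdist n a x) && (cdist n a x < cdist n a b).
(* x \in ]a,b]  (empty when a = b) *)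
Definition in_oc (n a b x : nat) : bool :=
  (x < n) && (0 < cdist n a x) && (cdist n a x <= cdist n a b).

Local Open Scope ring_scope.

Definition sigma (p : partition) (S : pred nat) : int :=
  \sum_(x < npts p | S x) (if ncol p x then 1 else -1).

Definition pair_nb (p : partition) : Prop :=
  (forall i, (i < npts p)%N ->
     count (fun j => blk p i j) (iota 0 (npts p)) = 2%N) /\
  (forall i j, (i < npts p)%N -> (j < npts p)%N -> i != j -> blk p i j ->
     ncol p i != ncol p j).

Definition S0 (p : partition) : Prop :=
  pair_nb p /\
  (forall i j, (i < npts p)%N -> (j < npts p)%N -> i != j -> blk p i j ->
     sigma p (in_oo (npts p) i j) = 0).

Definition delta (p : partition) (a b : nat) : int :=
  if ncol p a != ncol p b then sigma p (in_oo (npts p) a b)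
  else sigma p (in_oc (npts p) a b).

(* I_D : d_p(B,B') = |delta_p(x,y)| (x in B, y in B') is not in D for all
   crossing blocks B (containing a, b) and B' (containing c, d), where
   a, c, b, d occur in this cyclic order. *)
Definition I_D (D : nat -> Prop) (p : partition) : Prop :=
  wf p /\ S0 p /\
  (forall a b c d x y,
     (a < npts p)%N -> (b < npts p)%N -> (c < npts p)%N -> (d < npts p)%N ->
     (x < npts p)%N -> (y < npts p)%N ->
     blk p a b -> blk p c d -> ~~ blk p a c -> a != b ->
     in_oo (npts p) a b c -> in_oo (npts p) b a d ->
     blk p a x -> blk p c y ->
     ~ D `|delta p x y|%N).

Definition subsemigroup (D : nat -> Prop) : Prop :=
  forall x y, D x -> D y -> D (x + y)%N.

(* Main.v *)
Require Import Defs.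
From mathcomp Require Import all_boot all_order all_algebra.
From mathcomp Require Import zify.
Import Defs.
Set Implicit Arguments. Unset Strict Implicit. Unset Printing Implicit Defensive.
Import Order.TTheory GRing.Theory Num.Theory.
Local Open Scope ring_scope.

(* Give each point the level of the profile of partial color sums at that point.
   A pair partition with neutral blocks lies in S_0 iff the two points of each
   block have the same level, and delta_p is the difference of levels.  Levels
   agree across the points identified in a composition, so they are constant
   along the strings of the composite.  If two strings interlace at the boundary
   of the composite, then some block of the first crosses some block of the
   second inside p or p', at the same distance: otherwise the signed number of
   points of the second string preceding a point would be constant along the
   first string, and so would be equal at its two ends. *)

(** * Signs, partial sums and levels *)

Definition color_sign (c : bool) : int := if c then 1 else -1.

Lemma color_signN c : color_sign (~~ c) = - color_sign c.
Proof. by case: c. Qed.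

Definition csign (p : partition) (i : nat) : int := color_sign (ncol p i).
Definition psum (u : nat -> int) (k : nat) : int := \sum_(j < k) u j.

Lemma psum0 u : psum u 0 = 0.
Proof. by rewrite /psum big_ord0. Qed.

Lemma psumS u k : psum u k.+1 = psum u k + u k.
Proof. by rewrite /psum big_ord_recr. Qed.

Lemma eq_psum u v k : (forall i, (i < k)%N -> u i = v i) -> psum u k = psum v k.
Proof. by move=> uv; apply: eq_bigr => i _; apply: uv. Qed.

Lemma psum_ind u k n : (k <= n)%N ->
  psum u k = \sum_(x < n) (if (x < k)%N then u x else 0).
Proof. by move=> le_kn; rewrite -big_mkcond -big_ord_widen. Qed.

(* The height profile of the partial color sums crosses a unit interval at each
   point; [level] is the upper end of that interval. *)
Definition level (p : partition) (i : nat) : int :=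
  psum (csign p) i + (if ncol p i then 1 else 0).

(** A partner function in place of the relation [blk]; the condition on levels encodes the vanishing
    color sums of S_0. Values of [b] off the points are unconstrained. *)
Definition matching (p : partition) (b : nat -> nat) : Prop :=
  forall i, (i < npts p)%N ->
  [/\ (b i < npts p)%N, b (b i) = i, ncol p (b i) = ~~ ncol p i,
      level p (b i) = level p i &
      forall j, (j < npts p)%N -> blk p i j = (j == i) || (j == b i)].

(** For [c] outside the pair, this says that [c] lies between [a] and [b], whichever comes first;
    the symmetry avoids orienting blocks. *)
Definition between (a b c : nat) : bool := (c < a)%N (+) (c < b)%N.

Definition noncrossing_at (D : nat -> Prop) (p : partition) (b : nat -> nat) :=
  forall a c, (a < npts p)%N -> (c < npts p)%N -> c != a -> c != b a ->
  between a (b a) c != between a (b a) (b c) -> ~ D `|level p c - level p a|%N.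

(** Reindexing by the involution shows that the sum is its own negative. *)
Lemma sum_antisym n (b : nat -> nat) (u : nat -> int) :
  (forall i, (i < n)%N -> (b i < n)%N /\ b (b i) = i) ->
  (forall i, (i < n)%N -> u (b i) = - u i) -> \sum_(i < n) u i = 0.
Proof.
case: n => [|n] bP ub; first by rewrite big_ord0.
have bE (i : 'I_n.+1) : (inord (b i) : 'I_n.+1) = b i :> nat.
  by have [h _] := bP i (ltn_ord i); rewrite inordK.
have invb : involutive (fun i : 'I_n.+1 => inord (b i) : 'I_n.+1).
  by move=> i; have [_ h] := bP i (ltn_ord i); apply: val_inj; rewrite /= !bE.
suff : \sum_(i < n.+1) u i = - \sum_(i < n.+1) u i by lia.
rewrite {1}(reindex_inj (inv_inj invb)) -sumrN.
by apply: eq_bigr => i _; rewrite bE ub.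
Qed.

Lemma matching_total p b : matching p b -> psum (csign p) (npts p) = 0.
Proof.
move=> mb; apply: (@sum_antisym _ b) => i /mb [] // _ _ h _ _.
by rewrite /csign h; case: ncol.
Qed.

(** * Color sums over cyclic intervals *)

Lemma cdistE n a x : (a < n)%N -> (x < n)%N ->
  cdist n a x = (if (a <= x)%N then x - a else x + n - a)%N.
Proof.
move=> an xn; rewrite /cdist; case: leqP => ax; last by rewrite modn_small; lia.
by rewrite (_ : x + n - a = x - a + n)%N ?modnDr ?modn_small; lia.
Qed.

Lemma in_ooE n a b x : (a < n)%N -> (b < n)%N -> (x < n)%N -> a != b ->
  in_oo n a b x = if (a < b)%N then (a < x < b)%N else (a < x)%N || (x < b)%N.
Proof.
move=> an bn xn ab; rewrite /in_oo !cdistE // xn.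
by case: (ltngtP a b) => ?; case: (leqP a x) => ?; lia.
Qed.

Lemma in_ocE n a b x : (a < n)%N -> (b < n)%N -> (x < n)%N ->
  in_oc n a b x = if (a <= b)%N then (a < x <= b)%N else (a < x)%N || (x <= b)%N.
Proof.
move=> an bn xn; rewrite /in_oc !cdistE // xn.
by case: (ltngtP a b) => ?; case: (leqP a x) => ?; lia.
Qed.

Lemma sigmaE p S :
  sigma p S = \sum_(x < npts p) (if S x then csign p x else 0).
Proof. by rewrite /sigma big_mkcond. Qed.

Lemma sigma_oo p i j : psum (csign p) (npts p) = 0 ->
  (i < npts p)%N -> (j < npts p)%N -> i != j ->
  sigma p (in_oo (npts p) i j) = psum (csign p) j - psum (csign p) i.+1.
Proof.
move=> tot lti ltj nij.
(* If the interval wraps around, the difference of partial sums misses the full sum exactly once,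
   and [tot] makes that zero. *)
have E : sigma p (in_oo (npts p) i j) =
    psum (csign p) j - psum (csign p) i.+1 + (if (j < i)%N then psum (csign p) (npts p) else 0).
  rewrite (psum_ind _ (ltnW ltj)) (psum_ind _ lti) /psum sigmaE.
  have -> : (if (j < i)%N then \sum_(x < npts p) csign p x else 0) =
            \sum_(x < npts p) (if (j < i)%N then csign p x else 0).
    by case: ifP => // _; rewrite big1.
  rewrite -sumrB -big_split; apply: eq_bigr => x _ /=.
  have ltx := ltn_ord x; rewrite in_ooE // !ltnS.
  by case: (ltngtP i j) => ?; case: (ltngtP i x) => ?; case: (ltngtP x j) => ? /=; lia.
by rewrite E tot; case: ifP; rewrite addr0.
Qed.

Lemma sigma_oc p i j : psum (csign p) (npts p) = 0 ->
  (i < npts p)%N -> (j < npts p)%N ->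
  sigma p (in_oc (npts p) i j) = psum (csign p) j.+1 - psum (csign p) i.+1.
Proof.
move=> tot lti ltj.
have E : sigma p (in_oc (npts p) i j) =
    psum (csign p) j.+1 - psum (csign p) i.+1 + (if (j < i)%N then psum (csign p) (npts p) else 0).
  rewrite (psum_ind _ ltj) (psum_ind _ lti) /psum sigmaE.
  have -> : (if (j < i)%N then \sum_(x < npts p) csign p x else 0) =
            \sum_(x < npts p) (if (j < i)%N then csign p x else 0).
    by case: ifP => // _; rewrite big1.
  rewrite -sumrB -big_split; apply: eq_bigr => x _ /=.
  have ltx := ltn_ord x; rewrite in_ocE // !ltnS.
  by case: (ltngtP i j) => ?; case: (ltngtP i x) => ?; case: (ltngtP x j) => ? /=; lia.
by rewrite E tot; case: ifP; rewrite addr0.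
Qed.

(* Hence d_p(B, B') is the distance between the levels of B and B'. *)
Lemma delta_level p i j : psum (csign p) (npts p) = 0 ->
  (i < npts p)%N -> (j < npts p)%N -> delta p i j = level p j - level p i.
Proof.
move=> tot lti ltj; rewrite /delta.
case: ifP => [nij|/negbFE /eqP eij].
  rewrite sigma_oo //; last by apply: contra nij => /eqP ->.
  rewrite psumS /level /csign /color_sign; case: (ncol p i) nij; case: (ncol p j) => // _; lia.
rewrite sigma_oc // !psumS /level /csign /color_sign eij; case: (ncol p j); lia.
Qed.

(** * Membership in [I_D] through partner functions and levels *)

Lemma matching_intro p : wf p ->
  (forall i, (i < npts p)%N -> exists j,
     [/\ (j < npts p)%N, blk p i j, ncol p j = ~~ ncol p i, level p j = level p i &
         forall k, (k < npts p)%N -> blk p i k -> k = i \/ k = j]) ->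
  exists b, matching p b.
Proof.
move=> [wr [ws wtr]] H.
have [f fP] := fin_all_exists (fun i : 'I_(npts p) => H i (ltn_ord i)).
pose b i := if insub i is Some k then f k else i.
have bP i : (i < npts p)%N ->
     [/\ (b i < npts p)%N, blk p i (b i), ncol p (b i) = ~~ ncol p i,
       level p (b i) = level p i &
         forall k, (k < npts p)%N -> blk p i k -> k = i \/ k = b i].
  by move=> lti; rewrite /b insubT; apply: (fP (Ordinal lti)).
exists b => i lti; have [ltb bib cb lb ub] := bP i lti; split=> //.
  have [_ _ cbb _ ubb] := bP _ ltb.
  case: (ubb i lti); rewrite // 1?ws // => /esym E.
  by move: cb; rewrite E; case: ncol.
move=> j ltj; apply/idP/idP => [/(ub _ ltj) [] ->|/orP[/eqP ->|/eqP ->]]; rewrite ?eqxx ?orbT //.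
exact: wr.
Qed.

Lemma matching_neq p b i : matching p b -> (i < npts p)%N -> b i != i.
Proof.
move=> mb /mb [_ _ h _ _]; apply/eqP => E; by move: h; rewrite E; case: ncol.
Qed.

Lemma matching_disjoint p b a c : matching p b -> (a < npts p)%N -> (c < npts p)%N ->
  c != a -> c != b a -> b c != a /\ b c != b a.
Proof.
move=> mb /mb [_ bba _ _ _] /mb [_ bbc _ _ _] nca ncb; split.
  by apply: contra ncb => /eqP <-; rewrite bbc.
by apply: contra nca => /eqP E; rewrite -bbc E bba.
Qed.

Lemma matching_wf p b : matching p b -> wf p.
Proof.
move=> mb; have E i j : (i < npts p)%N -> (j < npts p)%N -> blk p i j = (j == i) || (j == b i).
  by move=> /mb [_ _ _ _]; apply.
have bb i : (i < npts p)%N -> b (b i) = i by move=> /mb [].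
split; [|split].
- by move=> i lti; rewrite E ?eqxx.
- move=> i j lti ltj; rewrite !E // [i == j]eq_sym; congr orb.
  by apply/eqP/eqP => ->; rewrite bb.
- move=> i j k lti ltj ltk; rewrite !E // => /orP[/eqP -> //|/eqP -> /orP[/eqP ->|]].
    by rewrite eqxx orbT.
  by rewrite bb // => ->.
Qed.

(** Two-point blocks yield partners; once the full color sum is known to vanish, the S_0 condition
    on a block reads as equality of levels. *)
Lemma I_D_matching D p : I_D D p ->
  exists b, matching p b /\ noncrossing_at D p b.
Proof.
move=> [wfp [[[cnt opp] lvl] nc]]; have [wr [ws wtr]] := wfp.
pose n := npts p.
have mate i : (i < n)%N -> exists j, [/\ (j < n)%N, j != i, blk p i j &
         forall k, (k < n)%N -> blk p i k -> k = i \/ k = j].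
  move=> lti; have := cnt i lti; rewrite -size_filter.
  set s := filter _ _; have sE k : k \in s = (k < n)%N && blk p i k.
    by rewrite mem_filter mem_iota add0n andbC.
  have us : uniq s by rewrite filter_uniq ?iota_uniq.
  have : i \in s by rewrite sE lti wr.
  case: s sE us => [|x [|y []]] //= sE; rewrite inE andbT => nxy ii _.
  have [j nji jE] : exists2 j, j != i & forall k, (k \in [:: x; y]) = (k == i) || (k == j).
    move: ii; rewrite !inE => /orP[] /eqP ->.
      by exists y => [|k]; rewrite ?inE // eq_sym.
    by exists x => // k; rewrite !inE orbC.
  have : j \in [:: x; y] by rewrite jE eqxx orbT.
  rewrite sE => /andP[ltj bij]; exists j; split=> // k ltk bik.
  have : k \in [:: x; y] by rewrite sE ltk.
  by rewrite jE => /orP[] /eqP; [left|right].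
have oppE i j : (i < n)%N -> (j < n)%N -> i != j -> blk p i j -> ncol p j = ~~ ncol p i.
  by move=> lti ltj nij /(opp _ _ lti ltj nij); case: ncol; case: ncol.
(* [delta_level] presupposes that the full sum vanishes, so partners are chosen here once, just to
   cancel that sum in pairs. *)
have [f fP] : exists f : 'I_n -> 'I_n, forall i : 'I_n,
   [/\ f i != i, blk p i (f i) & forall k, (k < n)%N -> blk p i k -> k = i \/ k = f i].
  apply: (@fin_all_exists _ (fun=> 'I_n) (fun i j =>
    [/\ j != i, blk p i j & forall k, (k < n)%N -> blk p i k -> k = i \/ k = j])).
  by move=> i; have [j [ltj]] := mate i (ltn_ord i); exists (Ordinal ltj).
have tot : psum (csign p) n = 0.
  have ff : involutive f.
    move=> i; have [n1 b1 u1] := fP i; have [n2 b2 u2] := fP (f i).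
    have [] := u2 i (ltn_ord _).
    - by rewrite ws.
    - by move=> /ord_inj E; move: n1; rewrite -E eqxx.
    - by move=> /ord_inj E.
  suff : psum (csign p) n = - psum (csign p) n by lia.
  rewrite /psum {1}(reindex_inj (inv_inj ff)) -sumrN; apply: eq_bigr => i _.
  have [n1 b1 _] := fP i.
  by rewrite /csign (oppE i (f i)) // 1?eq_sym //; case: ncol.
have [|b mb] := @matching_intro p wfp.
  move=> i lti; have [j [ltj nji bij uj]] := mate i lti; exists j; split=> //.
    by rewrite (oppE i j) // eq_sym.
  have nij : i != j by rewrite eq_sym.
  have := delta_level tot lti ltj; rewrite /delta opp // lvl //.
  by move/esym/eqP; rewrite subr_eq0 => /eqP.
exists b; split=> // a c lta ltc nca ncb cr.
have [ltba bba _ _ Ea] := mb a lta; have [ltbc bbc _ _ Ec] := mb c ltc.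
have nba := matching_neq mb lta; have nab : a != b a by rewrite eq_sym.
have nbc := matching_neq mb ltc.
have [nbca nbcba] := matching_disjoint mb lta ltc nca ncb.
rewrite -(delta_level tot lta ltc).
(* [between] has no direction, so a crossing fits one of the two orientations of the cyclic
   definition. *)
have X : (in_oo n a (b a) c && in_oo n (b a) a (b c)) ||
         (in_oo n (b a) a c && in_oo n a (b a) (b c)).
  move: cr; rewrite !in_ooE // /between.
  by case: (ltngtP a (b a)) => ?; lia.
have nbac : ~~ blk p a c by rewrite Ea // (negPf nca) (negPf ncb).
have baa : blk p a (b a) by rewrite Ea // eqxx orbT.
have bcc : blk p c (b c) by rewrite Ec // eqxx orbT.
case/orP: X => /andP[X1 X2].
  by apply: (nc a (b a) c (b c) a c) => //; rewrite 1?eq_sym //; apply: wr.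
apply: (nc (b a) a c (b c) a c) => //; try exact: wr; try by rewrite ws.
by apply: contra nbac => h; apply: wtr h.
Qed.

(** Levels are constant on blocks, so the distance does not depend on the representatives [x] and
    [y]. *)
Lemma matching_I_D D p b : matching p b -> noncrossing_at D p b -> I_D D p.
Proof.
move=> mb nc; have wfp := matching_wf mb; have tot := matching_total mb.
have E i j : (i < npts p)%N -> (j < npts p)%N -> blk p i j = (j == i) || (j == b i).
  by move=> /mb [_ _ _ _]; apply.
split=> //; split.
  split; first split.
  - move=> i lti; have [ltb _ _ _ _] := mb i lti.
    have -> : count (fun j => blk p i j) (iota 0 (npts p)) =
              count (predU (pred1 i) (pred1 (b i))) (iota 0 (npts p)).
      by apply: eq_in_count => j; rewrite mem_iota => /andP[_ ltj]; rewrite E.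
    have := count_predUI (pred1 i) (pred1 (b i)) (iota 0 (npts p)).
    rewrite !count_uniq_mem ?iota_uniq // !mem_iota !add0n lti ltb /=.
    rewrite (_ : count (predI _ _) _ = 0%N) ?addn0 //; apply/eqP; rewrite -leqn0 leqNgt -has_count.
    apply/hasPn => j _ /=; apply/andP => -[/eqP -> /eqP Ei].
    by have := matching_neq mb lti; rewrite -Ei eqxx.
  - move=> i j lti ltj nij; rewrite E // eq_sym (negPf nij) => /eqP ->.
    by have [_ _ -> _ _] := mb i lti; case: ncol.
  - move=> i j lti ltj nij; rewrite E // eq_sym (negPf nij) => /eqP Ej.
    have [_ _ h l _] := mb i lti.
    by have := delta_level tot lti ltj; rewrite /delta Ej h l subrr; case: ncol.
move=> a b' c d x y lta ltb ltc ltd ltx lty.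
have [ltba bba _ la _] := mb a lta; have [ltbc bbc _ lc _] := mb c ltc.
rewrite !E // => /orP[/eqP ->|/eqP ->]; first by rewrite eqxx.
have nba := matching_neq mb lta; have nab : a != b a by rewrite eq_sym.
move=> cd; rewrite negb_or => /andP[nca ncb] _ o1 o2 ax cy.
(* If [d] were [c], then [c] would lie on both arcs cut off by the block of [a]. *)
have Ed : d = b c.
  by case/orP: cd => /eqP // Ed; move: o1 o2; rewrite Ed !in_ooE //; case: ltngtP => ?; lia.
rewrite delta_level //.
have -> : level p x = level p a by case/orP: ax => /eqP ->.
have -> : level p y = level p c by case/orP: cy => /eqP ->.
apply: nc => //; move: o1 o2; rewrite Ed !in_ooE // /between; case: ltngtP => ?; lia.
Qed.

Lemma I_D_peq D p q : I_D D p -> peq p q -> I_D D q.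
Proof.
case: p q => [u l bp] [u' l' bq] /I_D_matching[b [mb nc]] [/= <- [<- E]].
apply: (@matching_I_D D _ b); last exact: nc.
move=> i lti; have [h1 h2 h3 h4 h5] := mb i lti.
by split=> // j ltj; rewrite /= -E //; apply: h5.
Qed.

(** This serves the four generators: with a single block nothing can cross. *)
Lemma I_D_two D (p : partition) (c : bool) : npts p = 2%N ->
  (forall i j, blk p i j) -> ncol p 0 = c -> ncol p 1 = ~~ c -> I_D D p.
Proof.
move=> n2 bl c0 c1; apply: (@matching_I_D _ _ (fun i => 1 - i)%N).
  have lE : level p 1 = level p 0 by rewrite /level psumS psum0 /csign c0 c1; case: c {c0 c1}.
  move=> [|[|i]]; rewrite n2 // => _; split; rewrite ?subn0 ?subnn ?c0 ?c1 ?negbK //.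
    by move=> [|[|j]] //; rewrite bl.
  by move=> [|[|j]] //; rewrite bl.
by move=> [|[|a]] [|[|c']]; rewrite n2.
Qed.

(** * Involution *)

Lemma ncol_involution p i : (i < npts p)%N ->
  ncol (involution p) i = ~~ ncol p ((npts p).-1 - i).
Proof.
rewrite /npts /ncol /col /= => lti.
have [lt1|ge1] := ltnP i (size (up p)).
  rewrite ltnNge (_ : (size (lo p) <= _)%N = true) /=; last by lia.
  by rewrite negbK; congr nth; lia.
rewrite (_ : (_ < size (lo p))%N = true); last by lia.
by congr (~~ nth _ _ _); lia.
Qed.

Lemma csign_involution p i : (i < npts p)%N ->
  csign (involution p) i = - csign p ((npts p).-1 - i).
Proof. by move=> lti; rewrite /csign ncol_involution ?color_signN. Qed.

(** Order and signs are both reversed and the full sum is zero, so the same profile is retraced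
    backwards. Each point keeps its unit interval, hence its level, and reflection preserves
    crossings. *)
Lemma I_D_involution D p : I_D D p -> I_D D (involution p).
Proof.
move=> /I_D_matching[b [mb nc]].
have nE : npts (involution p) = npts p by rewrite /npts addnC.
have preE k : (k <= npts p)%N ->
    psum (csign (involution p)) k = psum (csign p) (npts p - k).
  elim: k => [|k IH] ltk; first by rewrite psum0 subn0 (matching_total mb).
  rewrite psumS IH 1?ltnW // (_ : npts p - k = (npts p - k.+1).+1)%N; last by lia.
  rewrite psumS csign_involution // (_ : (npts p).-1 - k = npts p - k.+1)%N; last by lia.
  by rewrite addrK.
pose r i := ((npts p).-1 - i)%N.
have ltr i : (i < npts p)%N -> (r i < npts p)%N by rewrite /r; lia.
have rr i : (i < npts p)%N -> r (r i) = i by rewrite /r; lia.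
have levE i : (i < npts p)%N -> level (involution p) i = level p (r i).
  move=> lti; rewrite /level preE 1?ltnW // (_ : npts p - i = (r i).+1)%N; last by rewrite /r; lia.
  rewrite psumS ncol_involution // -/(r i) [csign p _]/csign.
  by case: ncol; rewrite -addrA.
have eqr i j : (i < npts p)%N -> (j < npts p)%N -> (r i == j) = (i == r j) by rewrite /r; lia.
apply: (@matching_I_D _ _ (fun i => r (b (r i)))).
  move=> i; rewrite nE => lti; have [h1 h2 h3 h4 h5] := mb _ (ltr _ lti).
  split; rewrite ?ltr ?rr ?h2 ?rr //.
  - by rewrite !ncol_involution ?ltr // -/(r _) rr // h3.
  - by rewrite !levE ?ltr // rr.
  - by move=> j ltj /=; rewrite -!/(r _) h5 ?ltr // !eqr ?ltr ?rr.
move=> a c; rewrite nE => lta ltc nca ncb.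
have [h1 h2 h3 h4 h5] := mb _ (ltr _ lta).
have [k1 k2 k3 k4 k5] := mb _ (ltr _ ltc).
rewrite !levE // => cr.
have nca' : r c != r a by rewrite eqr ?ltr // rr.
have ncb' : r c != b (r a) by rewrite eqr ?ltr.
have [] := matching_disjoint mb (ltr _ lta) (ltr _ ltc) nca' ncb'.
move=> d1 d2; apply: nc; rewrite ?ltr // /between.
move: h1 k1 nca' ncb' d1 d2 cr; rewrite /between.
move: (b (r a)) (b (r c)) => x y; rewrite /r; lia.
Qed.

Lemma ltn_addF n k : (n + k < n)%N = false.
Proof. by rewrite ltnNge leq_addr. Qed.

(** * Tensor products *)

(** In the cyclic numbering the points of [q] form one contiguous run, inserted between the lower
    and the upper row of [p]; upper points of [p] are pushed past it. *)
Definition tens_out (p q : partition) (a : nat) : nat :=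
  if (a < size (lo p))%N then a else (a + npts q)%N.

Definition tens_in (p : partition) (a : nat) : nat := (size (lo p) + a)%N.

Lemma npts_tensor p q : npts (tensor p q) = (npts p + npts q)%N.
Proof. by rewrite /npts /= !size_cat; lia. Qed.

Lemma tens_loc_out p q a : tens_loc p q (tens_out p q a) = (true, a).
Proof.
rewrite /tens_loc /tens_out /npts; case: (ltnP a (size (lo p))) => h; first by rewrite h.
by do 3![rewrite (_ : (_ < _)%N = false); last by lia]; congr pair; lia.
Qed.

Lemma tens_loc_in p q a : (a < npts q)%N -> tens_loc p q (tens_in p a) = (false, a).
Proof.
rewrite /tens_loc /tens_in /npts => lta; rewrite (_ : (_ < _)%N = false); last by lia.
rewrite (_ : (_ + a < _ + _ + _)%N = true); last by lia.
by rewrite addKn; case: ifP.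
Qed.

Lemma tens_outP p q i : (i < npts (tensor p q))%N ->
  (exists2 a, (a < npts p)%N & i = tens_out p q a) \/
  (exists2 a, (a < npts q)%N & i = tens_in p a).
Proof.
rewrite npts_tensor /tens_out /tens_in /npts => lti.
have [lt1|ge1] := ltnP i (size (lo p)); first by left; exists i; rewrite ?lt1 //; lia.
have [lt2|ge2] := ltnP i (size (lo p) + npts q).
  by right; exists (i - size (lo p))%N; rewrite /npts in lt2 *; lia.
left; exists (i - npts q)%N; rewrite /npts in ge2 *; first by lia.
by rewrite (_ : (_ < _)%N = false); lia.
Qed.

Lemma ncol_tens_out p q a : (a < npts p)%N -> ncol (tensor p q) (tens_out p q a) = ncol p a.
Proof.
rewrite /ncol /col /tens_out /npts /= !size_cat => lta; case: (ltnP a (size (lo p))) => h.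
  by rewrite ltn_addr // nth_cat h.
rewrite (_ : (_ < _)%N = false); last by lia.
rewrite nth_cat (_ : (_ < size (up p))%N = true); last by lia.
by congr (~~ nth _ _ _); lia.
Qed.

Lemma ncol_tens_in p q a : (a < npts q)%N -> ncol (tensor p q) (tens_in p a) = ncol q a.
Proof.
rewrite /ncol /col /tens_in /npts /= !size_cat ltn_add2l => lta; case: ifP => h.
  by rewrite h nth_cat ltn_addF addKn.
rewrite h nth_cat (_ : (_ < size (up p))%N = false); last by lia.
by congr (~~ nth _ _ _); lia.
Qed.

(** The inserted run has sum zero, so it leaves the rest of the profile of [p] in place, while its
    own levels are shifted by the height at which it is inserted. *)
Lemma level_tensor p q : psum (csign q) (npts q) = 0 ->
  (forall a, (a < npts p)%N -> level (tensor p q) (tens_out p q a) = level p a) /\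
  (forall a, (a < npts q)%N -> level (tensor p q) (tens_in p a) =
     psum (csign p) (size (lo p)) + level q a).
Proof.
move=> tot; set u := csign (tensor p q).
have low k : (k <= size (lo p))%N -> psum u k = psum (csign p) k.
  move=> lek; apply: eq_psum => i lti; have lti' := leq_trans lti lek.
  rewrite /u /csign -(@ncol_tens_out p q i); last by rewrite /npts ltn_addr.
  by rewrite /tens_out lti'.
have mid a : (a <= npts q)%N -> psum u (tens_in p a) = psum (csign p) (size (lo p)) + psum (csign q) a.
  elim: a => [|a IH] lta; first by rewrite /tens_in addn0 low // psum0 addr0.
  rewrite /tens_in addnS psumS -/(tens_in p a) IH 1?ltnW // psumS -addrA.
  by congr (_ + (_ + _)); rewrite /u /csign ncol_tens_in.
have high t : (t <= size (up p))%N ->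
    psum u (size (lo p) + t + npts q)%N = psum (csign p) (size (lo p) + t)%N.
  elim: t => [|t IH] ltt; first by rewrite addn0 -/(tens_in p _) mid // tot addr0.
  rewrite addnS addSn psumS IH 1?ltnW // psumS; congr (_ + _).
  rewrite /u /csign -(@ncol_tens_out p q (_ + t)%N); last by rewrite /npts ltn_add2l.
  by rewrite /tens_out ltn_addF.
split=> a lta; rewrite /level; last by rewrite ncol_tens_in // mid 1?ltnW // addrA.
rewrite ncol_tens_out //; congr (_ + _); rewrite /tens_out; case: ifP => h.
  by rewrite low // ltnW.
have ge1 : (size (lo p) <= a)%N by rewrite leqNgt h.
rewrite -(subnKC ge1) high // leq_subLR; exact: ltnW.
Qed.

Lemma I_D_tensor D p q : I_D D p -> I_D D q -> I_D D (tensor p q).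
Proof.
move=> /I_D_matching[b [mb nc]] /I_D_matching[b' [mb' nc']].
have [levo levi] := level_tensor p (matching_total mb').
pose bt i := match tens_loc p q i with
             | (true, a) => tens_out p q (b a) | (false, a) => tens_in p (b' a) end.
have bo a : bt (tens_out p q a) = tens_out p q (b a) by rewrite /bt tens_loc_out.
have bi a : (a < npts q)%N -> bt (tens_in p a) = tens_in p (b' a).
  by move=> lta; rewrite /bt tens_loc_in.
have lto a : (a < npts p)%N -> (tens_out p q a < npts (tensor p q))%N.
  by rewrite npts_tensor /tens_out => lta; case: ifP => _; lia.
have lti a : (a < npts q)%N -> (tens_in p a < npts (tensor p q))%N.
  by rewrite npts_tensor /tens_in /npts => lta; lia.
have oo a c : (tens_out p q a == tens_out p q c) = (a == c).
  by rewrite /tens_out; case: ifP => ?; case: ifP => ?; lia.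
have oolt a c : (tens_out p q a < tens_out p q c)%N = (a < c)%N.
  by rewrite /tens_out; case: ifP => ?; case: ifP => ?; lia.
have ii a c : (tens_in p a == tens_in p c) = (a == c) by rewrite eqn_add2l.
have iilt a c : (tens_in p a < tens_in p c)%N = (a < c)%N by rewrite ltn_add2l.
have oi a c : (c < npts q)%N -> (tens_out p q a == tens_in p c) = false.
  by rewrite /tens_out /tens_in => ltc; case: ifP => ?; lia.
have oilt a c : (c < npts q)%N -> (tens_out p q a < tens_in p c)%N = (a < size (lo p))%N.
  by rewrite /tens_out /tens_in => ltc; case: ifP => ?; lia.
have iolt a c : (c < npts q)%N -> (tens_in p c < tens_out p q a)%N = (size (lo p) <= a)%N.
  by rewrite /tens_out /tens_in => ltc; case: (ltnP a (size (lo p))) => ?; lia.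
apply: (@matching_I_D _ _ bt).
  move=> i /tens_outP[] [a lta ->].
    have [h1 h2 h3 h4 h5] := mb a lta; rewrite !bo h2 !ncol_tens_out // !levo //; split=> //.
      exact: lto.
    move=> j /tens_outP[] [c ltc ->] /=; rewrite tens_loc_out.
      by rewrite tens_loc_out !oo h5.
    by rewrite tens_loc_in // ![tens_in _ _ == _]eq_sym !oi.
  have [h1 h2 h3 h4 h5] := mb' a lta; rewrite !bi // h2 !ncol_tens_in // !levi // h4; split=> //.
    exact: lti.
  move=> j /tens_outP[] [c ltc ->] /=; rewrite tens_loc_in //.
    by rewrite tens_loc_out !oi.
  by rewrite tens_loc_in // !ii h5.
move=> i j /tens_outP[] [a lta ->] /tens_outP[] [c ltc ->]; rewrite /between.
- rewrite !bo !oo !oolt !levo // => nca ncb cr; exact: nc.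
(* Blocks of different factors never cross, because the points of [q] occupy an interval. *)
- by have [h _ _ _ _] := mb' c ltc; rewrite bo bi // !iolt ?eqxx.
- by have [h _ _ _ _] := mb' a lta; rewrite bo bi // !oilt ?addbb.
- rewrite !bi // !ii !iilt !levi // => nca ncb cr.
  by rewrite opprD addrACA subrr add0r; apply: nc'.
Qed.

(** * Composition *)

(** The inductive step may use that [z] is connected to [x], so facts valid only for actual nodes
    can be propagated. *)
Lemma connect_inv (T : finType) (e : rel T) (P : T -> Prop) x :
  P x -> (forall z t, connect e x z -> e z t -> P z -> P t) ->
  forall y, connect e x y -> P y.
Proof.
move=> Px Pe y /connectP[s es ->]; elim/last_ind: s es => [|s z IH] //.
rewrite rcons_path last_rcons => /andP[es ez]; apply: Pe ez (IH es).
by apply/connectP; exists s.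
Qed.

(* Points of a glued diagram carry two involutions: [B] goes to the other point
   of the block, [M] through the glued line, with the outer points as its fixed
   points.  Alternating [B] and [M] from an outer point ends at another one. *)
Lemma path_end (T : finType) (e : rel T) (B M : T -> T) (s : T -> bool) (x : T) :
  involutive B -> involutive M ->
  (forall z t, e z t -> [\/ t = z, t = B z | t = M z]) ->
  (forall z, connect e x z -> connect e x (B z) /\ connect e x (M z)) ->
  (forall z, connect e x z -> s (B z) = ~~ s z) ->
  (forall z, connect e x z -> M z != z -> s (M z) = ~~ s z) ->
  M x = x ->
  exists y, [/\ M y = y, connect e x y, s y = ~~ s x &
    forall z, connect e x z -> M z = z -> z = x \/ z = y].
Proof.
move=> BK MK eE cl sB sM Mx.
pose f z := B (M z); pose w j := iter j f (B x).
have fI : injective f by apply: inj_comp (inv_inj MK); apply: inv_inj.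
(* [f] is a permutation and [f x = B x], so the walk returns to [x], which [M] fixes; the first
   fixed point met is the end sought. *)
have exk : exists k, M (w k) == w k.
  exists (order f (f x)).-1; have := finv_f fI x; rewrite /finv /w /f Mx => ->.
  by rewrite Mx.
case: (ex_minnP exk) => k /eqP Mk kmin.
have cw j : connect e x (w j).
  elim: j => [|j IH]; first by case: (cl x).
  by rewrite /w iterS; case: (cl (M (w j))) => //; case: (cl _ IH).
have Mw j : (j < k)%N -> M (w j) != w j.
  by move=> ltj; apply/negP => /kmin; rewrite leqNgt ltj.
exists (w k); split=> //.
  (* Each round flips the sign twice, so the walk keeps the sign opposite to that of [x]. *)
  suff H j : (j <= k)%N -> s (w j) = ~~ s x by apply: H.
  elim: j => [|j IH] ltj; first by rewrite /w /= sB.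
  rewrite /w iterS -/(w j) /f sB; last by case: (cl _ (cw j)).
  by rewrite sM ?Mw // negbK IH // ltnW.
(* The points visited up to time [k]; closure under [B] and [M] makes this the whole component, and
   minimality of [k] leaves only [x] and [w k] as fixed points. *)
pose S z := z = x \/ exists2 j, (j <= k)%N & z = w j \/ z = M (w j).
have SB z : S z -> S (B z).
  case=> [->|[[|j] ltj [] ->]].
  - by right; exists 0%N => //; left.
  - by left; rewrite /w /= BK.
  - have [k0|nk] := eqVneq k 0%N.
      by left; move: Mk; rewrite k0 /w /= => ->; rewrite BK.
    by right; exists 1%N; [rewrite lt0n|left].
  - by right; exists j; [apply: ltnW|right; rewrite /w iterS BK].
  - have [Ek|nk] := eqVneq j.+1 k.
      by right; exists j; [apply: ltnW|right; move: Mk; rewrite -Ek => ->; rewrite /w iterS BK].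
    by right; exists j.+2; [rewrite ltn_neqAle nk|left].
have SM z : S z -> S (M z).
  case=> [->|[j ltj [] ->]]; first by left.
    by right; exists j => //; right.
  by right; exists j => //; left; rewrite MK.
have SP z : connect e x z -> S z.
  apply: connect_inv; first by left.
  by move=> {}z t _ /eE[] -> // Sz; [apply: SB|apply: SM].
move=> z /SP[->|[j ltj H]] Mz; first by left.
have zj : z = w j by case: H => // E; rewrite -Mz E MK.
move: ltj; rewrite leq_eqVlt => /orP[/eqP <-|/Mw]; first by right.
by rewrite -zj Mz eqxx.
Qed.

(* An algebraic form of: strings that cross the block of [z] nowhere contribute
   zero to the signed count of points on either side of it. *)
Lemma psum_matching p b (u : nat -> int) z : matching p b -> (z < npts p)%N ->
  (forall i, (i < npts p)%N -> u (b i) = - u i) ->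
  (forall c, (c < npts p)%N -> u c != 0 -> between z (b z) c = between z (b z) (b c)) ->
  psum u (b z) = psum u z.
Proof.
move=> mb ltz ub bt; have [ltbz _ _ _ _] := mb z ltz.
apply/eqP; rewrite -subr_eq0 (psum_ind _ (ltnW ltz)) (psum_ind _ (ltnW ltbz)) -sumrB.
apply/eqP; apply: (@sum_antisym _ b (fun x => (if (x < b z)%N then u x else 0) - (if (x < z)%N then u x else 0))) => i lti.
  by have [] := mb i lti.
have := bt _ lti; rewrite ub // /between.
have [->|nz] := eqVneq (u i) 0; first by rewrite oppr0 !if_same subr0 oppr0.
(* Where [u] is nonzero, [i] and its partner lie on the same side of the block, so the two
   indicators have the same difference at both. *)
move=> /(_ isT); case: (ltnP i z) => ?; case: (ltnP i (b z)) => ? /=;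
 case: (ltnP (b i) z) => ?; case: (ltnP (b i) (b z)) => ? //=; lia.
Qed.

Lemma psum_two (u : nat -> int) y y' k : y != y' ->
  (forall j, (j < k)%N -> j != y -> j != y' -> u j = 0) ->
  psum u k = (if (y < k)%N then u y else 0) + (if (y' < k)%N then u y' else 0).
Proof.
move=> nyy; elim: k => [|k IH] u0; first by rewrite psum0.
rewrite psumS IH => [|j ltj]; last exact/u0/ltnW.
rewrite !ltnS; have [<-|ny] := eqVneq y k.
  rewrite ltnn leqnn add0r addrC; congr (_ + _).
  by rewrite [in RHS]leq_eqVlt eq_sym (negPf nyy).
rewrite [in RHS]leq_eqVlt (negPf ny) -addrA; congr (_ + _).
have [<-|ny'] := eqVneq y' k; first by rewrite ltnn leqnn add0r.
by rewrite [in RHS]leq_eqVlt (negPf ny') (u0 k) 1?eq_sym // addr0.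
Qed.

(* [W] weighs the nodes of the glued graph, [0..N-1] being the points of the top
   partition and [N..] those of the bottom one, which has [l] lower points and
   is glued along [m] points; weights cancel across the glue.  [F] sums the
   weights within each of the two partitions. *)
Lemma psum_glue (W : nat -> int) N l m :
  (m <= N)%N -> (forall i, (i < m)%N -> W (N + l + (m.-1 - i))%N = - W i) ->
  psum (fun j => W (N + j)%N) (l + m) = 0 ->
  let F z := if (z < N)%N then psum W z else psum (fun j => W (N + j)%N) (z - N) in
  let loc i := (if i < l then N + i else i - l + m)%N in
  (forall i, (i < m)%N -> F (N + l + (m.-1 - i))%N = F i + W i) /\
  (forall i, (i < l + (N - m))%N -> psum (fun j => W (loc j)) i = F (loc i)).
Proof.
move=> le_mN WM tot F loc; set u := fun j => _ in tot F *.
(* The upper row of the bottom partition, read backwards from its zero total, repeats the sums along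
   the lower row of the top one. *)
have mid i : (i <= m)%N -> psum u (l + m - i) = psum W i.
  elim: i => [|i IH] lti; first by rewrite subn0 psum0.
  rewrite psumS -IH 1?ltnW // (_ : l + m - i = (l + m - i.+1).+1)%N; last by lia.
  rewrite psumS (_ : u (l + m - i.+1)%N = - W i) ?subrK //.
  by rewrite -WM // /u; congr W; lia.
split=> i lti.
  rewrite /F (_ : (_ < N)%N = false) 1?(_ : (i < N)%N = true); try lia.
  by rewrite -psumS -mid //; congr psum; lia.
have low j : (j <= l)%N -> psum (fun j => W (loc j)) j = psum u j.
  by move=> le_jl; apply: eq_psum => i' lti'; rewrite /loc (leq_trans lti' le_jl).
rewrite /F /loc; case: (ltnP i l) => [lti'|le_li].
  by rewrite (low i (ltnW lti')) (_ : (_ < N)%N = false) ?addKn //; lia.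
rewrite (_ : (_ < N)%N = true); last by lia.
(* The boundary jumps from the last lower point to position [m] of the top partition; [mid] at [m]
   says that the sums agree there. *)
rewrite -(subnKC le_li) addKn; move: (i - l)%N => t.
elim: t => [|t IH]; first by rewrite addn0 low // -mid // addnK.
by rewrite addnS psumS IH addSn psumS /loc ltnNge leq_addr /= addKn.
Qed.

(** * The glued graph *)

(* Nodes of the graph in the definition of [pcompose]: the points of [q], then
   those of [p] shifted by [npts q]. *)
Definition gsize (p q : partition) : nat := npts q + npts p.

(** Kept convertible to the relation inside [pcompose], so that [blkE] below holds by
    computation. *)
Definition gedge (p q : partition) (x y : nat) : bool :=
  let m := size (lo q) in let l := size (lo p) in
  (x < gsize p q)%N && (y < gsize p q)%N &&
    [|| (x < npts q)%N && (y < npts q)%N && blk q x y,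
        (npts q <= x)%N && (npts q <= y)%N && blk p (x - npts q) (y - npts q),
        (x < m)%N && (y == npts q + l + (m.-1 - x))%N |
        (y < m)%N && (x == npts q + l + (m.-1 - y))%N].

Definition gloc (p q : partition) (i : nat) : nat :=
  if (i < size (lo p))%N then (npts q + i)%N else (i - size (lo p) + size (lo q))%N.

(** Like [gid], the identity off the nodes, so that both give involutions on an ordinal type with
    one spare element. *)
Definition gmate (p q : partition) (b b' : nat -> nat) (z : nat) : nat :=
  if (z < npts q)%N then b' z
  else if (z < gsize p q)%N then (npts q + b (z - npts q))%N else z.

Definition gid (p q : partition) (z : nat) : nat :=
  let m := size (lo q) in let l := size (lo p) in
  if (z < m)%N then (npts q + l + (m.-1 - z))%N
  else if (npts q + l <= z < gsize p q)%N then (m.-1 - (z - (npts q + l)))%N else z.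

Definition gcol (p q : partition) (z : nat) : bool :=
  if (z < npts q)%N then ncol q z else ncol p (z - npts q).

Definition glevel (p q : partition) (z : nat) : int :=
  if (z < npts q)%N then level q z else level p (z - npts q).

Lemma gmateP p q b b' z : matching p b -> matching q b' -> (z < gsize p q)%N ->
  [/\ (gmate p q b b' z < gsize p q)%N,
      gcol p q (gmate p q b b' z) = ~~ gcol p q z,
      glevel p q (gmate p q b b' z) = glevel p q z &
      gmate p q b b' (gmate p q b b' z) = z].
Proof.
move=> mb mb'; rewrite /gmate /gcol /glevel /gsize => ltz.
case: (ltnP z (npts q)) => [lt1|ge1].
  have [h1 h2 h3 h4 _] := mb' z lt1; rewrite h1; split=> //; lia.
have lt2 : (z - npts q < npts p)%N by lia.
have [h1 h2 h3 h4 _] := mb _ lt2; rewrite ltz ltn_addF addKn ltn_add2l h1.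
by split=> //; rewrite h2 subnKC.
Qed.

(** Glued points share their color but sit in opposite rows. *)
Lemma ncol_glue p q i : lo q = up p -> (i < size (lo q))%N ->
  ncol p (size (lo p) + ((size (lo q)).-1 - i)) = ~~ ncol q i.
Proof.
move=> E lti; rewrite /ncol /col ltnNge leq_addr /= lti addKn -E.
by congr (~~ nth _ _ _); lia.
Qed.

Lemma gidP p q z : lo q = up p -> (z < gsize p q)%N ->
  [/\ (gid p q z < gsize p q)%N, gid p q (gid p q z) = z &
      gid p q z != z -> gcol p q (gid p q z) = ~~ gcol p q z].
Proof.
move=> E ltz.
have K i : (i < size (lo q))%N -> gcol p q (npts q + size (lo p) + ((size (lo q)).-1 - i)) = ~~ gcol p q i.
  move=> lti; have ltq : (i < npts q)%N by rewrite /npts; lia.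
  by rewrite /gcol ltq -(ncol_glue E lti) ltnNge -addnA leq_addr addKn.
have nE : gsize p q = (npts q + size (lo p) + size (lo q))%N.
  by rewrite /gsize /npts -E; lia.
have nq : (size (lo q) <= npts q)%N by rewrite /npts leq_addr.
rewrite /gid nE in ltz *; case: (ltnP z (size (lo q))) => [lt1|ge1].
  rewrite (_ : (_ + _ < size (lo q))%N = false) 1?(_ : (_ <= _ < _)%N = true); try lia.
  by split; [lia|lia|rewrite K].
case: ifP => [/andP[lt2 _]|h]; last by rewrite [(z < size (lo q))%N]ltnNge ge1 h eqxx; split.
rewrite (_ : (_ < size (lo q))%N = true); last by lia.
split; [lia|lia|move=> _].
set t := ((size (lo q)).-1 - _)%N; rewrite -[gcol p q t]negbK -K; last by rewrite /t; lia.
by congr (~~ gcol p q _); rewrite /t; lia.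
Qed.

(** This puts the graph in the form required by [path_end]. *)
Lemma gedgeE p q b b' z t : matching p b -> matching q b' -> lo q = up p ->
  (z < gsize p q)%N -> (t < gsize p q)%N ->
  gedge p q z t = [|| t == z, t == gmate p q b b' z | t == gid p q z].
Proof.
move=> mb mb' E ltz ltt.
have nE : gsize p q = (npts q + size (lo p) + size (lo q))%N.
  by rewrite /gsize /npts -E; lia.
have nq : (size (lo q) <= npts q)%N by rewrite /npts leq_addr.
rewrite /gedge ltz ltt /=.
have gidE : [|| t == z | t == gid p q z] = 
  [|| t == z, (z < size (lo q))%N && (t == npts q + size (lo p) + ((size (lo q)).-1 - z))%N |
        (t < size (lo q))%N && (z == npts q + size (lo p) + ((size (lo q)).-1 - t))%N].
  rewrite /gid nE in ltz ltt *; case: (ltnP z (size (lo q))) => [lt1|ge1] /=; first by lia.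
  by case: ifP => h; lia.
rewrite [gmate _ _ _ _ _ in RHS]/gmate ltz.
have mE : [|| (z < npts q)%N && (t < npts q)%N && blk q z t |
       (npts q <= z)%N && (npts q <= t)%N && blk p (z - npts q) (t - npts q)] =
  (t == z) || (t == (if z < npts q then b' z else npts q + b (z - npts q))%N).
  case: (ltnP z (npts q)) => [lt1|ge1] /=; case: (ltnP t (npts q)) => [lt2|ge2] //=.
  - by have [_ _ _ _ ->] := mb' z lt1; rewrite ?orbF.
  - have [h _ _ _ _] := mb' z lt1; lia.
  - lia.
  - have lt3 : (z - npts q < npts p)%N by rewrite /gsize in ltz; lia.
    have lt4 : (t - npts q < npts p)%N by rewrite /gsize in ltt; lia.
    have [_ _ _ _ ->] := mb _ lt3; rewrite // -(eqn_add2l (npts q)) subnKC // subnKC //.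
    by rewrite -[t in (t == npts q + _)%N](subnKC ge2) eqn_add2l.
by rewrite orbA mE -orbA orbCA -gidE orbCA.
Qed.

Lemma npts_pcompose p q : npts (pcompose p q) = (size (lo p) + size (up q))%N.
Proof. by []. Qed.

(** With [gloc_surj]: the points of the composite are exactly the nodes fixed by the gluing, that
    is, the ends of strings. *)
Lemma glocP p q i : lo q = up p -> (i < npts (pcompose p q))%N ->
  (gloc p q i < gsize p q)%N /\ gid p q (gloc p q i) = gloc p q i.
Proof.
rewrite npts_pcompose /gid /gsize /gloc /npts => E lti; rewrite -E.
case: (ltnP i (size (lo p))) => [lt1|ge1]; split; try lia.
  rewrite (_ : (_ < size (lo q))%N = false); last by lia.
  by rewrite (_ : (_ <= _ < _)%N = false); last by lia.
rewrite (_ : (_ < size (lo q))%N = false); last by lia.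
by rewrite (_ : (_ <= _ < _)%N = false); last by lia.
Qed.

Lemma gloc_surj p q z : lo q = up p -> (z < gsize p q)%N -> gid p q z = z ->
  exists2 i, (i < npts (pcompose p q))%N & gloc p q i = z.
Proof.
rewrite npts_pcompose /gid /gsize /npts => E; rewrite -E => ltz.
case: (ltnP z (size (lo q))) => [lt1|ge1]; first by lia.
case: ifP => h; first by lia.
move=> _; have [lt2|ge2] := ltnP z (size (lo q) + size (up q)).
  exists (z - size (lo q) + size (lo p))%N; first by lia.
  by rewrite /gloc ltnNge leq_addl /= addnK subnK.
exists (z - npts q)%N; first by rewrite /npts; lia.
by rewrite /gloc (_ : (_ < _)%N = true) /npts; lia.
Qed.

Lemma gid_lower p q z : lo q = up p -> gid p q z != z -> (size (lo q) <= z)%N ->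
  (gid p q z < size (lo q))%N.
Proof.
move=> E nM ge1; move: nM; rewrite /gid ltnNge ge1 /=.
by case: ifP; [rewrite /gsize /npts -E; lia|rewrite eqxx].
Qed.

Lemma ncol_pcompose p q i : (i < npts (pcompose p q))%N ->
  ncol (pcompose p q) i = gcol p q (gloc p q i).
Proof.
rewrite npts_pcompose /gcol /gloc /npts => lti; rewrite /ncol /col /=.
case: (ltnP i (size (lo p))) => [lt1|ge1].
  by rewrite (_ : (_ < _ + size (up q))%N = false) ?addKn ?lt1 //; lia.
rewrite (_ : (_ < _ + size (up q))%N = true) 1?(_ : (_ < size (lo q))%N = false); try lia.
by congr (~~ nth _ _ _); lia.
Qed.

Lemma glevel_pcompose p q b : matching p b -> lo q = up p ->
  (forall i, (i < npts (pcompose p q))%N -> level (pcompose p q) i = glevel p q (gloc p q i)) /\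
  (forall z, (z < gsize p q)%N -> glevel p q (gid p q z) = glevel p q z).
Proof.
move=> mb E; pose W z := color_sign (gcol p q z).
have nq : (size (lo q) <= npts q)%N by rewrite /npts leq_addr.
have Wp j : W (npts q + j)%N = csign p j.
  by rewrite /W /gcol ltnNge leq_addr /= addKn.
have preq z : (z <= npts q)%N -> psum W z = psum (csign q) z.
  by move=> lez; apply: eq_psum => i lti; rewrite /W /gcol (leq_trans lti lez).
have prep z : psum (fun j => W (npts q + j)%N) z = psum (csign p) z.
  by apply: eq_psum => i _; rewrite Wp.
have [||G1 G2] := @psum_glue W (npts q) (size (lo p)) (size (lo q)) nq.
- move=> i lti; rewrite -addnA Wp /csign ncol_glue // color_signN /W /gcol.
  by rewrite (leq_trans lti nq).
- by rewrite prep E; apply: matching_total mb.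
have FE z : (z < gsize p q)%N ->
    (if (z < npts q)%N then psum W z else psum (fun j => W (npts q + j)%N) (z - npts q))
    = glevel p q z - (if gcol p q z then 1 else 0).
  move=> ltz; rewrite /glevel /gcol; case: ifP => h; rewrite /level addrK //.
  by apply: preq; apply: ltnW.
split=> [i lti|].
  have [ltl _] := glocP E lti.
  rewrite /level ncol_pcompose // -[RHS](subrK (if gcol p q (gloc p q i) then 1 else 0)) -FE //.
  congr (_ + _); rewrite -G2; last by rewrite /npts addKn.
  apply: eq_psum => j ltj; rewrite /csign ncol_pcompose //; exact: ltn_trans ltj lti.
(* Glued points traverse the same unit interval of the profile in opposite directions, so they share
   its upper end. *)
have low z : (z < size (lo q))%N -> glevel p q (gid p q z) = glevel p q z.
  move=> ltz; have ltzg : (z < gsize p q)%N by rewrite /gsize; lia.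
  have [h1 _ h3] := gidP E ltzg.
  have := G1 z ltz; rewrite (_ : (npts q + _ + _)%N = gid p q z); last by rewrite /gid ltz.
  rewrite !FE // h3; last by rewrite /gid ltz; lia.
  by rewrite /W; case: gcol => /=; rewrite /color_sign; lia.
move=> z ltz; have [ltM MK _] := gidP E ltz.
have [|ge1] := ltnP z (size (lo q)); first exact: low.
have [->//|nM] := eqVneq (gid p q z) z.
by rewrite -[in RHS]MK [RHS]low // gid_lower.
Qed.

(** * Closure under composition *)

Lemma I_D_compose D p q : I_D D p -> I_D D q -> lo q = up p -> I_D D (pcompose p q).
Proof.
move=> /I_D_matching[b [mb nc]] /I_D_matching[b' [mb' nc']] E.
have [levE levM] := glevel_pcompose mb E.
pose T := 'I_(gsize p q).+1.
pose e : rel T := fun x y => gedge p q x y.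
pose nd z : T := inord z.
have ndE z : (z < gsize p q)%N -> nd z = z :> nat by move=> ltz; rewrite /nd inordK // ltnW.
pose B (z : T) : T := nd (gmate p q b b' z).
pose M (z : T) : T := nd (gid p q z).
(* The spare element of [T] is isolated and fixed by [B] and [M]. *)
have junk (z : T) : (z < gsize p q)%N \/ z = gsize p q :> nat.
  by have := ltn_ord z; rewrite ltnS leq_eqVlt => /orP[/eqP|]; auto.
have ltB (z : T) : (z < gsize p q)%N -> (B z < gsize p q)%N /\ B z = gmate p q b b' z :> nat.
  by move=> ltz; have [h _ _ _] := gmateP mb mb' ltz; rewrite ndE.
have ltM (z : T) : (z < gsize p q)%N -> (M z < gsize p q)%N /\ M z = gid p q z :> nat.
  by move=> ltz; have [h _ _] := gidP E ltz; rewrite ndE.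
have Bnd z : (z < gsize p q)%N -> B (nd z) = gmate p q b b' z :> nat.
  by move=> ltz; have [|_ ->] := ltB (nd z); rewrite ndE.
have Mnd z : (z < gsize p q)%N -> M (nd z) = gid p q z :> nat.
  by move=> ltz; have [|_ ->] := ltM (nd z); rewrite ndE.
have BK : involutive B.
  move=> z; apply: val_inj; have [ltz|ez] := junk z; rewrite /=.
    have [h1 h2] := ltB z ltz; have [_ ->] := ltB _ h1.
    by rewrite h2; have [_ _ _ ->] := gmateP mb mb' ltz.
  have BE : B z = z.
    by apply: val_inj; rewrite /B ez /gmate ltnn ltnNge leq_addr /= /nd inordK.
  by rewrite !BE.
have MK : involutive M.
  move=> z; apply: val_inj; have [ltz|ez] := junk z; rewrite /=.
    have [h1 h2] := ltM z ltz; have [_ ->] := ltM _ h1.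
    by rewrite h2; have [_ -> _] := gidP E ltz.
  have ME : M z = z.
    apply: val_inj; rewrite /M ez /gid ltnn andbF (_ : (_ < size (lo q))%N = false).
      by rewrite /= /nd inordK.
    by rewrite /gsize /npts; lia.
  by rewrite !ME.
have eN (z t : T) : e z t -> (z < gsize p q)%N /\ (t < gsize p q)%N.
  by rewrite /e /gedge => /andP[/andP[]].
have eE (z t : T) : (z < gsize p q)%N -> (t < gsize p q)%N ->
    e z t = [|| t == z, t == B z | t == M z].
  move=> ltz ltt; rewrite /e (gedgeE mb mb') //.
  by have [_ <-] := ltB z ltz; have [_ <-] := ltM z ltz.
have eP (z t : T) : e z t -> [\/ t = z, t = B z | t = M z].
  by move=> ezt; have [ltz ltt] := eN _ _ ezt; move: ezt; rewrite eE // => /or3P[] /eqP;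
    [constructor 1|constructor 2|constructor 3].
have esym : symmetric e.
  move=> z t; apply/idP/idP => ezt; have [ltz ltt] := eN _ _ ezt;
  by rewrite eE //; case: (eP _ _ ezt) => ->; rewrite ?BK ?MK eqxx ?orbT.
have csym := sym_connect_sym esym.
have cN (x z : T) : (x < gsize p q)%N -> connect e x z -> (z < gsize p q)%N.
  by move=> ltx; move: z; apply: connect_inv => // z t _ /eN[].
have cB (x z : T) : (x < gsize p q)%N -> connect e x z -> connect e x (B z).
  move=> ltx xz; have ltz := cN _ _ ltx xz; apply: connect_trans xz (connect1 _).
  by rewrite eE ?eqxx ?orbT //; case: (ltB z ltz).
have cM (x z : T) : (x < gsize p q)%N -> connect e x z -> connect e x (M z).
  move=> ltx xz; have ltz := cN _ _ ltx xz; apply: connect_trans xz (connect1 _).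
  by rewrite eE ?eqxx ?orbT //; case: (ltM z ltz).
have sB (z : T) : (z < gsize p q)%N -> gcol p q (B z) = ~~ gcol p q z.
  by move=> ltz; have [_ ->] := ltB z ltz; have [_ -> _ _] := gmateP mb mb' ltz.
have sM (z : T) : (z < gsize p q)%N -> M z != z -> gcol p q (M z) = ~~ gcol p q z.
  move=> ltz nM; have [_ ME] := ltM z ltz; rewrite ME; have [_ _ h] := gidP E ltz.
  by apply: h; rewrite -ME.
have clev (x z : T) : (x < gsize p q)%N -> connect e x z -> glevel p q z = glevel p q x.
  move=> ltx; move: z; apply: connect_inv => // z t xz /eP et <-.
  have ltz := cN _ _ ltx xz; case: et => -> //.
    by have [_ ->] := ltB z ltz; have [_ _ -> _] := gmateP mb mb' ltz.
  by have [_ ->] := ltM z ltz; rewrite levM.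
pose nl i := nd (gloc p q i).
have blkE i j : blk (pcompose p q) i j = connect e (nl i) (nl j) by [].
have nlP i : (i < npts (pcompose p q))%N ->
    [/\ (nl i < gsize p q)%N, nl i = gloc p q i :> nat & M (nl i) = nl i].
  move=> lti; have [h1 h2] := glocP E lti; rewrite /nl ndE //; split=> //.
  by rewrite /M ndE // h2.
have glI i j : (i < npts (pcompose p q))%N -> (j < npts (pcompose p q))%N ->
    gloc p q i = gloc p q j -> i = j.
  rewrite npts_pcompose /gloc /npts; case: ifP; case: ifP; lia.
have wfc : wf (pcompose p q).
  split; [|split] => [i _|i j _ _|i j k _ _ _]; rewrite !blkE.
  - exact: connect0.
  - exact: csym.
  - exact: connect_trans.
have [|bq mbq] := matching_intro wfc.
  move=> i lti; have [ltx xE Mx] := nlP i lti.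
  (* The partner of a boundary point is the other end of its string, with the normalized color as
     the alternating sign. *)
  have [||||y [My cy sy uy]] := @path_end T e B M (fun z => gcol p q z) (nl i) BK MK eP.
  - by move=> z xz; split; [apply: cB|apply: cM].
  - by move=> z /(cN _ _ ltx) /sB.
  - by move=> z /(cN _ _ ltx) /sM.
  - exact: Mx.
  have lty := cN _ _ ltx cy.
  have [|j ltj jE] := @gloc_surj p q y E lty.
    by have [_ <-] := ltM y lty; rewrite My.
  have yE : y = nl j by apply: val_inj; rewrite /= /nl ndE ?jE.
  exists j; split=> //.
  - by rewrite blkE -yE.
  - by rewrite !ncol_pcompose // jE sy xE.
  - by rewrite !levE // jE -xE; apply: clev.
  move=> k ltk; rewrite blkE => ck.
  have [_ kE Mk] := nlP k ltk; case: (uy (nl k) ck Mk) => Ek; [left|right]; apply: glI => //.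
    by rewrite -kE -xE Ek.
  by rewrite -kE Ek jE.
apply: (matching_I_D mbq) => a c lta ltc nca ncb cr Dac.
have [lta' _ _ _ Ea] := mbq a lta; have [ltc' _ _ _ Ec] := mbq c ltc.
have [ltx xE _] := nlP a lta; have [lty yE _] := nlP c ltc.
have disj (z : T) : connect e (nl a) z -> ~~ connect e (nl c) z.
  move=> az; apply/negP => cz.
  have : blk (pcompose p q) a c.
    by rewrite blkE; apply: connect_trans az _; rewrite csym.
  by rewrite Ea // (negPf nca) (negPf ncb).
(* [W] is supported on the string of [c]; its partial sums are constant along
   the string of [a] because, at the level difference in [D], no block of the
   one crosses a block of the other within [p] or [q]. *)
pose W z : int := if connect e (nl c) (nd z) then color_sign (gcol p q z) else 0.
have ndK (z : T) : nd z = z by rewrite /nd inord_val.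
have WB (z : T) : (z < gsize p q)%N -> W (B z) = - W z.
  move=> ltz; rewrite /W !ndK sB // color_signN.
  have -> : connect e (nl c) (B z) = connect e (nl c) z.
    by apply/idP/idP => /cB; rewrite ?BK; apply.
  by case: ifP; rewrite ?oppr0.
have WM (z : T) : (z < gsize p q)%N -> M z != z -> W (M z) = - W z.
  move=> ltz nM; rewrite /W !ndK sM // color_signN.
  have -> : connect e (nl c) (M z) = connect e (nl c) z.
    by apply/idP/idP => /cM; rewrite ?MK; apply.
  by case: ifP; rewrite ?oppr0.
have nq : (size (lo q) <= npts q)%N by rewrite /npts leq_addr.
have Wb' i : (i < npts q)%N -> W (b' i) = - W i.
  move=> lti; have lti' : (i < gsize p q)%N by rewrite /gsize ltn_addr.
  by have := WB (nd i); rewrite Bnd // ndE // /gmate lti => /(_ lti').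
have Wb i : (i < npts p)%N -> W (npts q + b i)%N = - W (npts q + i)%N.
  move=> lti; have lti' : (npts q + i < gsize p q)%N by rewrite /gsize ltn_add2l.
  have := WB (nd (npts q + i)%N); rewrite Bnd // ndE // => /(_ lti').
  by rewrite /gmate ltnNge leq_addr /= lti' addKn.
pose F z := if (z < npts q)%N then psum W z else psum (fun j => W (npts q + j)%N) (z - npts q).
have [||G1 G2] := @psum_glue W (npts q) (size (lo p)) (size (lo q)) nq.
- move=> i lti; have lti' : (i < gsize p q)%N by rewrite /gsize; lia.
  have gE : gid p q i = (npts q + size (lo p) + ((size (lo q)).-1 - i))%N by rewrite /gid lti.
  have := WM (nd i); rewrite Mnd // ndE // gE; apply=> //.
  by apply/eqP => /(congr1 val) /=; rewrite Mnd // ndE // gE; lia.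
- rewrite E; apply: (@sum_antisym _ b (fun i => W (npts q + i)%N)) => i lti.
    by have [] := mb i lti.
  exact: Wb.
have {}G1 z : (z < size (lo q))%N -> F (gid p q z) = F z + W z.
  by move=> ltz; rewrite -G1 // /gid ltz.
have {}G2 i : (i < npts (pcompose p q))%N -> psum (fun j => W (gloc p q j)) i = F (gloc p q i).
  by move=> lti; apply: G2; rewrite /npts addKn.
(* The level difference is the same for any two points of the two strings, so it lies in [D] and
   excludes crossings in [p] and [q]. *)
have cross (z w : T) : connect e (nl a) z -> connect e (nl c) w ->
    [/\ w <> z :> nat, w <> B z :> nat & D `|glevel p q w - glevel p q z|%N].
  move=> az cw; split.
  - by move=> /val_inj wz; have := disj z az; rewrite -wz cw.
  - by move=> /val_inj wz; have := disj (B z) (cB _ _ ltx az); rewrite -wz cw.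
  - by rewrite (clev _ _ ltx az) (clev _ _ lty cw) xE yE -!levE.
have Wc w : (w < gsize p q)%N -> W w != 0 -> connect e (nl c) (nd w).
  by rewrite /W; case: ifP => //; rewrite eqxx.
have F_B (z : T) : connect e (nl a) z -> F (B z) = F z.
  move=> az; have ltz := cN _ _ ltx az; have [_ BE] := ltB z ltz; rewrite BE /F /gmate ltz.
  have [lt1|ge1] := ltnP z (npts q).
    have [-> _ _ _ _] := mb' z lt1; apply: (psum_matching mb') => // w ltw nw.
    have ltw' : (w < gsize p q)%N by rewrite /gsize ltn_addr.
    have [] := cross z (nd w) az (Wc _ ltw' nw); rewrite BE ndE // /gmate lt1 /glevel lt1 ltw.
    move=> wz wBz Dwz; apply/eqP; apply: contraPT Dwz => /nc'; apply=> //; exact/eqP.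
  have lt2 : (z - npts q < npts p)%N by rewrite ltn_subLR.
  rewrite ltn_addF ?addKn.
  apply: (psum_matching mb) => // w ltw nw.
  have ltw' : (npts q + w < gsize p q)%N by rewrite /gsize ltn_add2l.
  have [] := cross z (nd (npts q + w)%N) az (Wc _ ltw' nw).
  rewrite BE ndE // /gmate ltz ltnNge ge1 /= /glevel (ltnNge z) ge1 /=.
  rewrite ltn_addF ?addKn.
  move=> wz wBz Dwz; apply/eqP; apply: contraPT Dwz => /nc; apply=> //; apply/eqP; lia.
have F_M (z : T) : connect e (nl a) z -> F (M z) = F z.
  (* Passing the glue changes [F] by the weight of [t], which is zero off the string of [c]. *)
  have low (t : T) : connect e (nl a) t -> (t < size (lo q))%N -> F (M t) = F t.
    move=> at' ltt; have [_ ->] := ltM t (cN _ _ ltx at').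
    by rewrite G1 // /W ndK (negPf (disj _ at')) addr0.
  move=> az; have [|ge1] := ltnP z (size (lo q)); first exact: low.
  have [->//|nM] := eqVneq (M z) z.
  have ltz := cN _ _ ltx az; have [_ ME] := ltM z ltz.
  rewrite -[in RHS](MK z) [RHS]low //; first exact: cM.
  by rewrite ME gid_lower // -ME; apply: contra nM => /eqP /val_inj ->.
have Fc (z : T) : connect e (nl a) z -> F z = F (nl a).
  by move: z; apply: connect_inv => // z t az /eP et <-; case: et => ->; rewrite ?F_B ?F_M.
(* The invariant is now read along the boundary of the composite, where only [c] and [bq c] carry
   weight, with opposite signs. *)
have Faa : psum (fun j => W (gloc p q j)) (bq a) = psum (fun j => W (gloc p q j)) a.
  rewrite !G2 // -xE -(Fc (nl (bq a))); first by have [_ ->] := nlP _ lta'.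
  by rewrite -blkE Ea // eqxx orbT.
have WcE j : (j < npts (pcompose p q))%N ->
    W (gloc p q j) = if (j == c) || (j == bq c) then csign (pcompose p q) j else 0.
  by move=> ltj; rewrite -Ec // blkE /W /csign ncol_pcompose.
have nbc : c != bq c by rewrite eq_sym; apply: matching_neq mbq ltc.
have pre2 k : (k < npts (pcompose p q))%N -> psum (fun j => W (gloc p q j)) k =
    (if (c < k)%N then csign (pcompose p q) c else 0) - (if (bq c < k)%N then csign (pcompose p q) c else 0).
  move=> ltk; rewrite (psum_two nbc) => [|j ltj nj1 nj2]; last first.
    by rewrite WcE ?(negPf nj1) ?(negPf nj2) // (ltn_trans ltj ltk).
  rewrite !WcE // !eqxx orbT /=; congr (_ + _).
  have [_ _ h _ _] := mbq c ltc.
  by rewrite /csign h color_signN; case: ifP; rewrite ?oppr0.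
(* A crossing would put exactly one of [c], [bq c] between [a] and [bq a], and the two sums would
   differ by a nonzero sign. *)
move: Faa cr; rewrite !pre2 // /between.
have : csign (pcompose p q) c != 0 by rewrite /csign; case: ncol.
case: (ltnP c a) => ?; case: (ltnP c (bq a)) => ?; case: (ltnP (bq c) a) => ?;
 case: (ltnP (bq c) (bq a)) => ? //=; lia.
Qed.

Theorem theorem1 (D : nat -> Prop) : subsemigroup D -> category (I_D D).
Proof.
move=> _; split; [by move=> p []|split; [exact: I_D_peq|]].
split; first exact: I_D_tensor.
split; first exact: I_D_compose.
split; first exact: I_D_involution.
split; first exact: (@I_D_two _ _ white).
split; first exact: (@I_D_two _ _ black).
by split; [exact: (@I_D_two _ _ white)|exact: (@I_D_two _ _ black)].
Qed.
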